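(* Let $0<\mu\le L$, $\kappa=L/\mu$, $f\in S_{\mu,L}(\mathbb{R}^d)$, $\sigma>0$, and let $\Delta\ge f(x_0^0)-f^*$. Put $$n_1=\left\lceil\sqrt{\kappa}\log\Big(\frac{2L\Delta}{\sigma^2\sqrt{\kappa}}\Big)\right\rceil$$ and assume $n_1\ge1$. Run the algorithm M-ASG with this $n_1$, $\alpha_1=\frac1L$ and, for $k\ge2$, $n_k=2^k\lceil\sqrt{\kappa}\log(8)\rceil$ and $\alpha_k=\frac{1}{2^{2k}L}$. Then for all integers $n>n_1$, $$\mathbb{E}[f(x_n)]-f^*\le36(1+\log(8))\frac{\sigma^2}{(n-n_1)\mu},$$ where $x_n$ denotes the iterate of M-ASG after $n$ gradient steps.
   Context: $S_{\mu,L}(\mathbb{R}^d)$ is the set of continuously differentiable $f:\mathbb{R}^d\to\mathbb{R}$ with $\frac{\mu}{2}\|x-y\|^2\le f(x)-f(y)-\nabla f(y)^\top(x-y)\le\frac L2\|x-y\|^2$ for all $x,y$. $x^*$ is the unique minimizer of $f$, $f^*=f(x^* )$; $\log$ is the natural logarithm. Stochastic oracle with noise level $\sigma$: each time the algorithm needs a gradient at a query point $z$ (a function of the initial point and of the randomness used in earlier queries), it receives $\tilde\nabla f(z,w)$, where the random variables $w$ used in the different queries are independent, so that $w$ is independent of all the past, and $\mathbb{E}[\tilde\nabla f(z,w)\mid z]=\nabla f(z)$, $\mathbb{E}[\|\tilde\nabla f(z,w)-\nabla f(z)\|^2\mid z]\le\sigma^2$. M-ASG (Multistage Accelerated Stochastic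 Gradient) with stage lengths $n_k\in\mathbb{N}$ and stepsizes $\alpha_k\in(0,1/L]$, from a deterministic initial point $x_0^0\in\mathbb{R}^d$: for stages $k=1,2,\dots$, let $\beta_k=\frac{1-\sqrt{\mu\alpha_k}}{1+\sqrt{\mu\alpha_k}}$; set $x_0^k=x_1^k=x_{n_{k-1}+1}^{k-1}$ (for $k=1$: $x_0^1=x_1^1=x_0^0$); and for $m=1,\dots,n_k$ set $y_m^k=(1+\beta_k)x_m^k-\beta_k x_{m-1}^k$ and $x_{m+1}^k=y_m^k-\alpha_k\tilde\nabla f(y_m^k,w_m^k)$. Iterate after $n$ gradient steps: $x_0=x_0^0$, $x_n=x^1_{n+1}$ for $1\le n\le n_1$, and for $n>n_1$, $x_n=x^k_{m+1}$, where $k\ge2$ is the stage with $N_{k-1}<n\le N_k$, $N_k=\sum_{i=1}^k n_i$, and $m=n-N_{k-1}$. *)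

(* Defs.v *)
From HB Require Import structures.
From mathcomp Require Import all_boot all_order all_algebra finmap.
From mathcomp Require Import all_classical all_reals all_analysis.

Set Implicit Arguments.
Unset Strict Implicit.
Unset Printing Implicit Defensive.
Import Order.TTheory GRing.Theory Num.Theory.
Import numFieldNormedType.Exports.
Local Open Scope classical_set_scope.
Local Open Scope ring_scope.

(* The library's norm `|x| on 'rV[R]_d is the sup norm, so the Euclidean norm
   is defined here.  The two induce the same topology, hence differentiability
   and Borel sets are taken from the library structure. *)
Section euclidean.
Context {R : realType} {d : nat}.
Implicit Types (x y : 'rV[R]_d) (f : 'rV[R]_d -> R).

Definition dotp x y : R := \sum_(i < d) x 0 i * y 0 i.

Definition enorm x : R := Num.sqrt (dotp x x).

Definition grad f x : 'rV[R]_d := \row_(i < d) 'D_(delta_mx 0 i) f x.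

Definition S_class (mu L : R) f : Prop :=
  [/\ forall x, differentiable f x,
      continuous (grad f)
    & forall x y,
        mu / 2 * enorm (x - y) ^+ 2 <= f x - f y - dotp (grad f y) (x - y)
          <= L / 2 * enorm (x - y) ^+ 2].

End euclidean.

Definition borel_rV (R : realType) (d : nat) :=
  g_sigma_algebraType (@open 'rV[R]_d).

Section probability_notions.
Context {dO : measure_display} {Omega : measurableType dO} {R : realType}
  (P : probability Omega R).

(* Mutual independence of the subfamily (X i), i in D. *)
Definition mutually_independent {dW : measure_display} {W : measurableType dW}
    {I : choiceType} (D : set I) (X : I -> {RV P >-> W}) : Prop :=
  forall (J : {fset I}) (A : I -> set W),
    [set` J] `<=` D -> (forall i, measurable (A i)) ->
    P (\bigcap_(i in [set` J]) (X i @^-1` A i)) =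
    (\prod_(i <- J) P (X i @^-1` A i))%E.

(* Y is a version of E[X | z], i.e. of the conditional expectation of X given
   the sigma-algebra generated by z. *)
Definition is_cond_expectation {dZ : measure_display} {Z : measurableType dZ}
    (z : Omega -> Z) (X Y : Omega -> R) : Prop :=
  [/\ P.-integrable setT (EFin \o X),
      P.-integrable setT (EFin \o Y),
      measurable_fun setT (Y : g_sigma_algebra_preimageType z -> R)
    & forall A, g_sigma_algebra_preimage z A ->
        (\int[P]_(o in A) (X o)%:E = \int[P]_(o in A) (Y o)%:E)%E].

(* Quality of the answer gt z w to a query at the random point z: unbiased
   (coordinatewise conditional mean) with conditional variance E[|| ||^2 | z]
   at most sigma^2 almost surely. *)
Definition oracle_answer {d : nat} {W : Type} (sigma : R)
    (f : 'rV[R]_d -> R) (gt : 'rV[R]_d -> W -> 'rV[R]_d)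
    (z : Omega -> 'rV[R]_d) (w : Omega -> W) : Prop :=
  (forall j : 'I_d,
     is_cond_expectation (z : Omega -> borel_rV R d)
       (fun o => gt (z o) (w o) 0 j) (fun o => grad f (z o) 0 j)) /\
  (exists2 V : Omega -> R,
     is_cond_expectation (z : Omega -> borel_rV R d)
       (fun o => enorm (gt (z o) (w o) - grad f (z o)) ^+ 2) V
     & {ae P, forall o, V o <= sigma ^+ 2}).

End probability_notions.

(* For a realisation of the noise, G k m y is the answer of the oracle to the
   m-th query of stage k when the query point is y.  Stages and steps are
   numbered from 1; values at stage 0 are never used. *)
Section masg.
Context {R : realType} {d : nat}.
Variables (mu : R) (n_ : nat -> nat) (alpha : nat -> R) (x0 : 'rV[R]_d)
  (G : nat -> nat -> 'rV[R]_d -> 'rV[R]_d).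

Definition masg_beta (k : nat) : R :=
  (1 - Num.sqrt (mu * alpha k)) / (1 + Num.sqrt (mu * alpha k)).

(* x_0 = x_1 = s and x_(m+1) = y_m - alpha G_m(y_m) for m >= 1,
   with y_m = (1 + beta) x_m - beta x_(m-1). *)
Fixpoint stage_iter (k : nat) (s : 'rV[R]_d) (m : nat) : 'rV[R]_d :=
  match m with
  | (m1.+1 as m').+1 =>
      let y := (1 + masg_beta k) *: stage_iter k s m'
               - masg_beta k *: stage_iter k s m1 in
      y - alpha k *: G k m' y
  | _ => s
  end.

Fixpoint masg_start (k : nat) : 'rV[R]_d :=
  match k with
  | (_.+1 as k').+1 => stage_iter k' (masg_start k') (n_ k').+1
  | _ => x0
  end.

Definition masg_x (k m : nat) : 'rV[R]_d := stage_iter k (masg_start k) m.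

Definition masg_y (k m : nat) : 'rV[R]_d :=
  (1 + masg_beta k) *: masg_x k m - masg_beta k *: masg_x k m.-1.

Definition masg_N (k : nat) : nat := (\sum_(1 <= i < k.+1) n_ i)%N.

(* The stage k with N_(k-1) < n <= N_k, i.e. the least k with n <= N_k.  As
   stage lengths are positive, N_n >= n, so searching 0, ..., n suffices. *)
Definition masg_stage (n : nat) : nat :=
  find (fun k => (n <= masg_N k)%N) (iota 0 n.+1).

Definition masg_iterate (n : nat) : 'rV[R]_d :=
  if n == 0%N then x0
  else let k := masg_stage n in masg_x k (n - masg_N k.-1).+1.

Lemma masg_xE k m : (0 < m)%N ->
  masg_x k m.+1 = masg_y k m - alpha k *: G k m (masg_y k m).
Proof. by case: m. Qed.

Lemma masg_stageP n : (forall k, (0 < k)%N -> (0 < n_ k)%N) -> (0 < n)%N ->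
  [/\ (0 < masg_stage n)%N, (masg_N (masg_stage n).-1 < n)%N
    & (n <= masg_N (masg_stage n))%N].
Proof.
move=> n_gt0 n0.
have leN k : (k <= masg_N k)%N.
  elim: k => // k IH; rewrite /masg_N big_nat_recr//=.
  apply: (leq_ltn_trans IH); rewrite -[ltnLHS]addn0 ltn_add2l.
  exact: n_gt0.
have hs : has (fun k => (n <= masg_N k)%N) (iota 0 n.+1).
  by apply/hasP; exists n => //; rewrite mem_iota/=.
have hlt : (masg_stage n < n.+1)%N.
  by have := hs; rewrite has_find size_iota.
have hN : (n <= masg_N (masg_stage n))%N.
  by have := nth_find 0%N hs; rewrite nth_iota.
have s0 : (0 < masg_stage n)%N.
  rewrite lt0n; apply/eqP => s0; move: hN.
  by rewrite s0 /masg_N big_geq// leqNgt n0.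
split => //.
have lt1 : ((masg_stage n).-1 < masg_stage n)%N by rewrite prednK.
have := before_find 0%N lt1.
rewrite nth_iota ?(ltn_trans lt1)// add0n => /negbT.
by rewrite -ltnNge.
Qed.

End masg.

Definition oracle_answers {R : realType} {d : nat} {Omega W : Type}
    (gt : 'rV[R]_d -> W -> 'rV[R]_d) (w : nat -> nat -> Omega -> W) (o : Omega)
    : nat -> nat -> 'rV[R]_d -> 'rV[R]_d :=
  fun k m y => gt y (w k m o).

(* Main.v *)
(** One step of the scheme contracts, by a factor [1 - sqrt (mu * alpha)] and
    up to a noise term, the Lyapunov function
    [f x - f xs + |x - xs - (1 - s) (x' - xs)|^2 / (2 alpha)] of two consecutive
    iterates, where [s = sqrt (mu * alpha)].  The noise enters linearly through
    its product with a function of both iterates: it vanishes in mean because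
    the fresh randomness is independent of the past, so that, by Fubini, the
    conditional mean given the query point is the mean over the fresh randomness
    alone.  At the start of a stage the two iterates coincide and the Lyapunov
    function is at most twice the suboptimality.  With
    [B = sigma^2 / (mu * sqrt kappa)], the stage lengths make the suboptimality
    at most [2 B] after stage 1 and [4 B / 2^k] after stage k, hence at most
    [17 B / 2^k] inside stage k, while at most [2^(k+1) sqrt kappa (1 + ln 8)]
    steps have been made since the end of stage 1. *)

Require Import Defs.
From HB Require Import structures.
From mathcomp Require Import all_boot all_order all_algebra finmap.
From mathcomp Require Import all_classical all_reals all_analysis.
From mathcomp Require Import measurable_realfun ring lra.

Set Implicit Arguments.
Unset Strict Implicit.
Unset Printing Implicit Defensive.
Import Order.TTheory GRing.Theory Num.Theory.
Import numFieldNormedType.Exports.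
Local Open Scope classical_set_scope.
Local Open Scope ring_scope.

(** * The Lyapunov function *)

Section dot_product.
Context {R : realType} {d : nat}.
Implicit Types (x y z : 'rV[R]_d) (a : R).

Lemma dotpC x y : dotp x y = dotp y x.
Proof. by apply: eq_bigr => i _; rewrite mulrC. Qed.

Lemma dotpDl x y z : dotp (x + y) z = dotp x z + dotp y z.
Proof. by rewrite -big_split; apply: eq_bigr => i _ /=; rewrite mxE mulrDl. Qed.

Lemma dotpZl a x y : dotp (a *: x) y = a * dotp x y.
Proof. by rewrite mulr_sumr; apply: eq_bigr => i _; rewrite mxE mulrA. Qed.

Lemma dotp0l x : dotp 0 x = 0.
Proof. by rewrite -(scale0r x) dotpZl mul0r. Qed.

Lemma dotpNl x y : dotp (- x) y = - dotp x y.
Proof. by rewrite -scaleN1r dotpZl mulN1r. Qed.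

Lemma dotpDr x y z : dotp z (x + y) = dotp z x + dotp z y.
Proof. by rewrite dotpC dotpDl !(dotpC z). Qed.

Lemma dotpZr a x y : dotp y (a *: x) = a * dotp y x.
Proof. by rewrite dotpC dotpZl (dotpC y). Qed.

Lemma dotpNr x y : dotp y (- x) = - dotp y x.
Proof. by rewrite dotpC dotpNl (dotpC y). Qed.

Definition dotp_simp := (dotpDl, dotpDr, dotpNl, dotpNr, dotpZl, dotpZr).

Lemma dotp_ge0 x : 0 <= dotp x x.
Proof. by apply: sumr_ge0 => i _; rewrite -expr2 sqr_ge0. Qed.

Lemma dotp_eq0 x : dotp x x = 0 -> x = 0.
Proof.
move=> /eqP; rewrite psumr_eq0 => [/allP x0|i _]; last by rewrite -expr2 sqr_ge0.
apply/rowP => i; rewrite mxE.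
by have := x0 i (mem_index_enum _); rewrite mulf_eq0 orbb => /eqP.
Qed.

Lemma sqr_enorm x : enorm x ^+ 2 = dotp x x.
Proof. by rewrite sqr_sqrtr// dotp_ge0. Qed.

Lemma sqr_coord_le_dotp x i : x 0 i ^+ 2 <= dotp x x.
Proof.
rewrite /dotp (bigD1 i)//= -expr2 lerDl.
by apply: sumr_ge0 => j _; rewrite -expr2 sqr_ge0.
Qed.

End dot_product.

(** * Smoothness and strong convexity around the minimiser *)

Section smooth_strongly_convex.
Context {R : realType} {d : nat}.
Variables (mu L : R) (f : 'rV[R]_d -> R) (xs : 'rV[R]_d).
Hypotheses (mu0 : 0 < mu) (muL : mu <= L) (fS : S_class mu L f)
  (fmin : forall x, f xs <= f x).
Implicit Types x y : 'rV[R]_d.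

Let L0 : 0 < L. Proof. exact: lt_le_trans muL. Qed.

Lemma S_class_lower x y :
  f y + dotp (grad f y) (x - y) + mu / 2 * dotp (x - y) (x - y) <= f x.
Proof.
by have [_ _ /(_ x y)/andP[+ _]] := fS; rewrite sqr_enorm => ?; lra.
Qed.

Lemma S_class_upper x y :
  f x <= f y + dotp (grad f y) (x - y) + L / 2 * dotp (x - y) (x - y).
Proof.
by have [_ _ /(_ x y)/andP[_]] := fS; rewrite sqr_enorm => ?; lra.
Qed.

(* The minimum is at most the value after a gradient step of size 1/L. *)
Lemma dotp_grad_le x : dotp (grad f x) (grad f x) <= 2 * L * (f x - f xs).
Proof.
have := S_class_upper (x - L^-1 *: grad f x) x.
have := fmin (x - L^-1 *: grad f x).
rewrite [_ - _ - x]addrAC subrr add0r !dotp_simp.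
set g := dotp _ _; set fx' := f (_ - _) => h1 h2.
have : g / L <= 2 * (f x - f xs).
  move: h2; rewrite [X in _ + X](_ : _ = g / L / 2); first by lra.
  by field; rewrite gt_eqF.
by rewrite ler_pdivrMr// mulrAC.
Qed.

(** The right-hand side of [dotp_grad_le] is 0 at the minimiser. *)
Lemma grad_min0 : grad f xs = 0.
Proof.
apply: dotp_eq0; apply/eqP; rewrite eq_le dotp_ge0 andbT.
by rewrite (le_trans (dotp_grad_le _))// subrr mulr0.
Qed.

Lemma suboptimality_le x : f x - f xs <= L / 2 * dotp (x - xs) (x - xs).
Proof.
have := S_class_upper x xs.
by rewrite grad_min0 dotp0l; lra.
Qed.

Lemma suboptimality_ge x : mu / 2 * dotp (x - xs) (x - xs) <= f x - f xs.
Proof.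
have := S_class_lower x xs.
by rewrite grad_min0 dotp0l; lra.
Qed.

Lemma dotp_grad_le_dist x :
  dotp (grad f x) (grad f x) <= L ^+ 2 * dotp (x - xs) (x - xs).
Proof.
apply: le_trans (dotp_grad_le x) _.
have L2 : 0 <= 2 * L by rewrite mulr_ge0// ltW.
apply: le_trans (ler_wpM2l L2 (suboptimality_le x)) _.
by rewrite [leLHS](_ : _ = L ^+ 2 * dotp (x - xs) (x - xs))//; field.
Qed.

(** * Contraction of the Lyapunov function in one noisy step *)

Section lyapunov.
Variable alpha : R.
Hypotheses (alpha0 : 0 < alpha) (alphaL : L * alpha <= 1).
Let s := Num.sqrt (mu * alpha).

(** [x] is the current iterate and [x'] the previous one. As [s ^+ 2 = mu * alpha], the quadratic
    term is mu/2 |z - xs|^2 for Nesterov's auxiliary point z = x' + (x - x') / s. *)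
Definition lyapunov (x x' : 'rV[R]_d) : R :=
  let v := x - xs - (1 - s) *: (x' - xs) in
  f x - f xs + (2 * alpha)^-1 * dotp v v.

Lemma sqrt_mu_alpha_gt0 : 0 < s.
Proof. by rewrite sqrtr_gt0 mulr_gt0. Qed.

Lemma sqrt_mu_alpha_le1 : s <= 1.
Proof.
rewrite -sqrtr1 ler_sqrt// (le_trans _ alphaL)// ler_wpM2r// ltW//.
Qed.

Let ss : s ^+ 2 = mu * alpha.
Proof. by rewrite sqr_sqrtr// ltW// mulr_gt0. Qed.

Lemma suboptimality_le_lyapunov x x' : f x - f xs <= lyapunov x x'.
Proof.
by rewrite /lyapunov lerDl mulr_ge0 ?dotp_ge0// invr_ge0 mulr_ge0// ltW.
Qed.

(** With equal arguments the vector is s (x - xs), so the quadratic term is mu/2 |x - xs|^2, at most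
    the suboptimality by strong convexity. This is the cost of restarting the momentum at a new
    stage. *)
Lemma lyapunov_diag_le x : lyapunov x x <= 2 * (f x - f xs).
Proof.
rewrite /lyapunov; have -> : x - xs - (1 - s) *: (x - xs) = s *: (x - xs).
  by apply/rowP => i; rewrite !mxE; ring.
rewrite dotpZl dotpZr mulrA -expr2 ss.
have := suboptimality_ge x.
set D := dotp _ _; have -> : (2 * alpha)^-1 * (mu * alpha * D) = mu / 2 * D.
  by field; rewrite gt_eqF.
lra.
Qed.

(* With the minimiser at the origin, the momentum identity
   (1+s)y = 2x - (1-s)x' gives u = (1-s)v + s^2 y = s y + (1-s)(y-x); the first
   form is used with convexity of the square, the second with strong convexity
   at y towards xs and x. *)
Lemma lyapunov_step (beta : R) (x x' y u e : 'rV[R]_d) :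
  beta = (1 - s) / (1 + s) ->
  y = (1 + beta) *: x - beta *: x' ->
  u = y - xs - (1 - s) *: (x - xs) ->
  lyapunov (y - alpha *: (grad f y + e)) x <=
  (1 - s) * lyapunov x x' + dotp e ((L * alpha ^+ 2) *: grad f y - u) +
  alpha / 2 * (1 + L * alpha) * dotp e e.
Proof.
move=> betaE yE uE0; set g := grad f y.
have s0 := sqrt_mu_alpha_gt0; have s1 := sqrt_mu_alpha_le1.
have sn : 1 + s != 0 by rewrite gt_eqF// addr_gt0.
have sx := S_class_lower x y; have sxs := S_class_lower xs y.
have up := S_class_upper (y - alpha *: (g + e)) y.
rewrite -/g in sx sxs up.
(* [q] and [v] are opaque vectors; every difference in the three inequalities becomes a combination
   of [q], [v], [g] and [e]. *)
have [q qE] : exists q, q = y - xs by exists (y - xs).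
have [v vE] : exists v, v = x - xs - (1 - s) *: (x' - xs) by eexists.
have xE : x - xs = (1 + s) *: q - v.
  by rewrite qE vE yE betaE; apply/rowP => i; rewrite !mxE; field.
have uE : u = (1 - s) *: v + s ^+ 2 *: q.
  by rewrite uE0 xE qE; apply/rowP => i; rewrite !mxE; ring.
have E1 : x - y = s *: q - v.
  by rewrite -[x](subrK xs) xE qE; apply/rowP => i; rewrite !mxE; ring.
have E2 : xs - y = - q by rewrite qE opprB.
have E3 : y - alpha *: (g + e) - y = - (alpha *: (g + e)).
  by rewrite addrAC subrr add0r.
rewrite /lyapunov -vE.
have -> : y - alpha *: (g + e) - xs - (1 - s) *: (x - xs) =
    u - alpha *: (g + e).
  by rewrite uE0; apply/rowP => i; rewrite !mxE; ring.
move: sx sxs up; rewrite E1 E2 E3 uE !dotp_simp.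
rewrite !(dotpC q v) !(dotpC e g) !(dotpC v g) !(dotpC q g) !(dotpC v e) !(dotpC q e).
have qq := dotp_ge0 q; have vv := dotp_ge0 v.
have cvx : 0 <= dotp v v - s * dotp v q *+ 2 + s ^+ 2 * dotp q q.
  have := dotp_ge0 (v - s *: q); rewrite !dotp_simp (dotpC q v).
  by move/le_trans; apply; rewrite le_eqVlt; apply/orP; left; apply/eqP; ring.
have ee := dotp_ge0 e; have gg := dotp_ge0 g.
move: (f x) (f y) (f xs) (f (_ - _)) => fx fy fs fn.
move: (dotp q q) (dotp v v) (dotp v q) (dotp g q) (dotp g v) (dotp g g)
  (dotp g e) (dotp e e) (dotp e q) (dotp e v) cvx qq vv ee gg
  => qq vv vq gq gv gg ge ee eq ev cvx qq0 vv0 ee0 gg0 h1 h2 h3.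
rewrite -subr_ge0 in h1; rewrite -subr_ge0 in h2; rewrite -subr_ge0 in h3.
have s1' : 0 <= 1 - s by rewrite subr_ge0.
have h1' := mulr_ge0 s1' h1; have h2' := mulr_ge0 (ltW s0) h2.
have muE : mu = s ^+ 2 / alpha by rewrite ss mulfK// gt_eqF.
(* The first coefficient is the convexity defect of |(1-s) v + s (s q)|^2 / (2 alpha); the second
   pays for dropping the quadratic term of strong convexity at [x], where x - y = s q - v. *)
have c1 : 0 <= (s * (1 - s) / (2 * alpha) + (1 - s) * (mu / 2)) *
    (vv - s * vq *+ 2 + s ^+ 2 * qq).
  apply: mulr_ge0 => //; apply: addr_ge0.
    by rewrite divr_ge0 ?mulr_ge0// ltW.
  by rewrite mulr_ge0// divr_ge0// ltW.
(* The balance of |g|^2: a decrease alpha from the gradient step, against L alpha^2 / 2 from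
   smoothness and alpha / 2 from the quadratic term. *)
have c2 : 0 <= alpha / 2 * (1 - L * alpha) * gg.
  by rewrite !mulr_ge0 ?subr_ge0 ?invr_ge0// ltW.
(* The right side minus the left side is exactly the sum of the five nonnegative quantities
   collected above. *)
rewrite -subr_ge0.
apply: le_trans (addr_ge0 (addr_ge0 (addr_ge0 (addr_ge0 h3 h1') h2') c1) c2) _.
rewrite le_eqVlt; apply/orP; left; apply/eqP.
rewrite muE; field.
by rewrite gt_eqF.
Qed.
End lyapunov.
End smooth_strongly_convex.

(** * Borel sets of row vectors *)

Section borel_rV_theory.
Context {R : realType} {d : nat}.

Lemma continuous_measurable_borel_rV (g : 'rV[R]_d -> R) :
  continuous g -> measurable_fun setT (g : borel_rV R d -> R).
Proof.
move=> /continuousP cg; apply: (measurability _ (RGenOpens.measurableE R)).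
move=> _ [_ [a [b ->] <-]]; apply: sub_sigma_algebra.
by rewrite setTI; exact/cg/interval_open.
Qed.

Lemma measurable_coord (i : 'I_d) :
  measurable_fun setT (fun x : borel_rV R d => x 0 i : R).
Proof. by apply: continuous_measurable_borel_rV => x; exact: coord_continuous. Qed.

(* The boxes are countably many, so every open set is a countable union of them. *)
Lemma open_rational_box (U : set 'rV[R]_d) (x : 'rV[R]_d) :
  open U -> U x ->
  exists (q : 'rV[rat]_d) (e : rat),
    (forall i, `|x 0 i - ratr (q 0 i)| < ratr e) /\
    [set y : 'rV[R]_d | forall i, `|y 0 i - ratr (q 0 i)| < ratr e] `<=` U.
Proof.
move=> oU Ux.
have /nbhs_ballP[r /= r0 rU] : nbhs x U by exact: open_nbhs_nbhs.
(* With a radius below r / 2, the triangle inequality through the centre keeps the box inside the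
   ball of radius r around [x]. *)
have [e /andP[e0 er]] : exists e : rat, 0 < (ratr e : R) < r / 2.
  have [|e] := @rat_in_itvoo R 0 (r / 2); first by rewrite divr_gt0.
  by rewrite in_itv/= => ?; exists e.
have H (i : 'I_d) : exists q : rat, `|x 0 i - ratr q| < ratr e.
  have [|q] := @rat_in_itvoo R (x 0 i - ratr e) (x 0 i + ratr e).
    by rewrite ltrD2l (lt_trans _ e0)// oppr_lt0.
  rewrite in_itv/= => /andP[q1 q2]; exists q.
  by rewrite ltr_distlC; apply/andP; split.
have [q qP] := choice H.
exists (\row_i q i), e; split => [i|y /= yq]; first by rewrite mxE.
apply: rU; split => // i j; rewrite /ball/= !ord1.
have := yq j; have := qP j; rewrite !mxE => h1 h2.
rewrite (le_lt_trans (ler_distD (ratr (q j)) _ _))//.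
rewrite [r]splitr; apply: ltrD; first exact: lt_trans er.
by rewrite distrC; exact: lt_trans er.
Qed.

(** It suffices to treat preimages of open sets. Such a preimage is a countable union of preimages
    of rational boxes, each a finite intersection of coordinate events. *)
Lemma measurable_borel_rV {dT : measure_display} {T : measurableType dT}
    (X : T -> 'rV[R]_d) :
  (forall i, measurable_fun setT (fun t => X t 0 i)) ->
  measurable_fun setT (X : T -> borel_rV R d).
Proof.
move=> mX.
apply: (@measurability _ _ T (borel_rV R d) setT X (@open 'rV[R]_d)) => //.
move=> _ [U oU <-]; rewrite setTI.
pose box (p : 'rV[rat]_d * rat) : set 'rV[R]_d :=
  [set y | forall i, `|y 0 i - ratr (p.1 0 i)| < ratr p.2].
(* The union runs over codes of boxes; codes of no box, or of a box not inside [U], contribute the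
   empty set. *)
pose F (n : nat) : set T :=
  if @choice.unpickle ('rV[rat]_d * rat)%type n is Some p then
    if `[< box p `<=` U >] then X @^-1` box p else set0
  else set0.
suff -> : X @^-1` U = \bigcup_n F n.
  apply: bigcupT_measurable => n; rewrite /F.
  case: choice.unpickle => [p|]; last exact: measurable0.
  case: ifPn => _; last exact: measurable0.
  have -> : X @^-1` box p = \bigcap_(i in [set: 'I_d])
      (fun t => `|X t 0 i - ratr (p.1 0 i)|) @^-1` `]-oo, ratr p.2[%classic.
    apply/seteqP; split => [t /= bt i _|t bt i] /=.
      by rewrite in_itv/=; exact: bt.
    by have := bt i I; rewrite /= in_itv.
  apply: fin_bigcap_measurable => // i _.
  rewrite -[X in measurable X]setTI.
  have mf : measurable_fun setT (fun t => `|X t 0 i - ratr (p.1 0 i)|).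
    apply: measurableT_comp => //.
    by apply: measurable_funB => //; exact: mX.
  exact: mf.
apply/seteqP; split => [t Ut|t [n _]].
  have [q [e [xq qU]]] := open_rational_box oU Ut.
  exists (choice.pickle (q, e)) => //; rewrite /F choice.pickleK.
  by rewrite asboolT.
rewrite /F; case: choice.unpickle => // p.
by case: ifPn => // /asboolP pU /pU.
Qed.

Section vector_operations.
Context {dT : measure_display} {T : measurableType dT}.
Implicit Types X Y : T -> 'rV[R]_d.

Lemma measurable_borel_rV_coord X (i : 'I_d) :
  measurable_fun setT (X : T -> borel_rV R d) ->
  measurable_fun setT (fun t => X t 0 i).
Proof. exact: measurableT_comp (measurable_coord i). Qed.

Lemma measurable_borel_rVD X Y :
  measurable_fun setT (X : T -> borel_rV R d) ->
  measurable_fun setT (Y : T -> borel_rV R d) ->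
  measurable_fun setT ((fun t => X t + Y t) : T -> borel_rV R d).
Proof.
move=> mX mY; apply: measurable_borel_rV => i.
under eq_fun do rewrite mxE.
by apply: measurable_funD; exact: measurable_borel_rV_coord.
Qed.

Lemma measurable_borel_rVZ (a : R) X :
  measurable_fun setT (X : T -> borel_rV R d) ->
  measurable_fun setT ((fun t => a *: X t) : T -> borel_rV R d).
Proof.
move=> mX; apply: measurable_borel_rV => i.
under eq_fun do rewrite mxE.
by apply: measurable_funM => //; exact: measurable_borel_rV_coord.
Qed.

Lemma measurable_borel_rVB X Y :
  measurable_fun setT (X : T -> borel_rV R d) ->
  measurable_fun setT (Y : T -> borel_rV R d) ->
  measurable_fun setT ((fun t => X t - Y t) : T -> borel_rV R d).
Proof.
move=> mX mY; under eq_fun do rewrite -scaleN1r.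
by apply: measurable_borel_rVD => //; exact: measurable_borel_rVZ.
Qed.

End vector_operations.

Lemma continuous_measurable_rV_rV (g : 'rV[R]_d -> 'rV[R]_d) :
  continuous g -> measurable_fun setT (g : borel_rV R d -> borel_rV R d).
Proof.
move=> cg; apply: measurable_borel_rV => i.
apply: continuous_measurable_borel_rV => x.
apply: (@continuous_comp _ _ _ g (fun y : 'rV[R]_d => y 0 i)).
  exact: cg.
exact: coord_continuous.
Qed.

End borel_rV_theory.

(** * Independence of the fresh randomness from the past *)

Section independence.
Context {dO : measure_display} {Omega : measurableType dO} {R : realType}
  (P : probability Omega R).

Definition independent_rv {d1 d2 : measure_display}
    {S : measurableType d1} {W : measurableType d2}
    (V : Omega -> S) (w : Omega -> W) : Prop :=
  forall A B, measurable A -> measurable B ->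
    P (V @^-1` A `&` w @^-1` B) = (P (V @^-1` A) * P (w @^-1` B))%E.

(** * Sigma-algebras generated by subfamilies of the noise *)

Section cylinder.
Context {dW : measure_display} {W : measurableType dW} {I : choiceType}.
Variables (D : set I) (X : I -> {RV P >-> W}).

(** A pi-system generating the sigma-algebra of the variables indexed by [J], so that measures can
    be compared on it. *)
Definition cylinders (J : set I) : set_system Omega :=
  [set C | exists (K : {fset I}) (A : I -> set W),
    [/\ [set` K] `<=` J, forall i, measurable (A i)
      & C = \bigcap_(i in [set` K]) (X i @^-1` A i)]].

Lemma cylinders_setI (J : set I) : setI_closed (cylinders J).
Proof.
move=> _ _ [K1 [A1 [K1J mA1 ->]]] [K2 [A2 [K2J mA2 ->]]].
(* The families are arbitrary off their own index sets, hence the replacement by [setT] there. *)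
exists (K1 `|` K2)%fset, (fun i => (if i \in K1 then A1 i else setT) `&`
                                (if i \in K2 then A2 i else setT)).
split => [i /= | i |].
- by rewrite in_fsetU => /orP[]; [exact: K1J|exact: K2J].
- by apply: measurableI; case: ifP.
apply/seteqP; split => [t [h1 h2] i /= _ | t h].
  by split; case: ifP => // iK; [exact: h1|exact: h2].
by split=> i /= iK; have := h i; rewrite /= in_fsetU iK ?orbT => -[].
Qed.

Lemma cylindersT (J : set I) : cylinders J setT.
Proof.
exists fset0, (fun=> setT); split => //.
by apply/seteqP; split.
Qed.

Lemma cylinders_measurable (J : set I) : cylinders J `<=` measurable.
Proof.
move=> _ [K [A [_ mA ->]]]; apply: fin_bigcap_measurable => // i _.
exact: measurable_funPTI.
Qed.

Lemma cylinders_le (J J' : set I) : J `<=` J' -> cylinders J `<=` cylinders J'.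
Proof.
move=> JJ' _ [K [A [KJ mA ->]]]; exists K, A; split => //.
exact: subset_trans KJ JJ'.
Qed.

(** The sigma-algebra is carried by the type of the domain, so the general measurability lemmas for
    pairs, compositions and vector operations apply to it directly. *)
Definition past_measurable {dS : measure_display} {S : measurableType dS}
    (J : set I) (V : Omega -> S) : Prop :=
  measurable_fun setT (V : g_sigma_algebraType (cylinders J) -> S).

Lemma past_measurable_le {dS : measure_display} {S : measurableType dS}
    (J J' : set I) (V : Omega -> S) :
  J `<=` J' -> past_measurable J V -> past_measurable J' V.
Proof.
move=> JJ' mV _ B mB; have := mV measurableT B mB.
by apply: sub_sigma_algebra2; exact: cylinders_le.
Qed.

Lemma past_measurable_noise (J : set I) (i : I) : J i -> past_measurable J (X i).
Proof.
move=> Ji _ B mB; apply: sub_sigma_algebra; rewrite setTI.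
exists [fset i]%fset, (fun=> B); split => //.
- by move=> j /=; rewrite inE => /eqP ->.
- apply/seteqP; split => [t h j /=|t h]; first by rewrite inE => /eqP ->.
  by apply: (h i); rewrite /= inE.
Qed.

Hypothesis indX : mutually_independent D X.

(** As functions of [E] both sides are finite measures. They agree on cylinders by mutual
    independence, hence on the generated sigma-algebra by uniqueness on a pi-system. *)
Lemma independent_sigma_cylinders (J : set I) (i : I) (E : set Omega) (B : set W) :
  J `<=` D -> D i -> ~ J i -> <<s cylinders J >> E -> measurable B ->
  P (E `&` X i @^-1` B) = (P E * P (X i @^-1` B))%E.
Proof.
move=> JD Di nJi JE mB.
have mXB : measurable (X i @^-1` B) by exact: measurable_funPTI.
pose r : {nonneg R} := NngNum (fine_ge0 (measure_ge0 P (X i @^-1` B))).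
have rE C : mscale r P C = (P (X i @^-1` B) * P C)%E.
  by rewrite -[in RHS](fineK (fin_num_measure P _ mXB)).
have H : mrestr P mXB E = mscale r P E.
  apply: (g_sigma_algebra_measure_unique (cylinders J) _ (fun=> setT)) => //.
  - exact: cylinders_measurable.
  - by move=> _; exact: cylindersT.
  - by rewrite bigcup_const.
  - exact: cylinders_setI.
  - move=> _ [K [A [KJ mA ->]]]; rewrite [RHS]rE.
    have iK : i \notin K by apply/negP => iK; apply: nJi; exact: KJ.
    (* Since [i] is not in [K], the value of [A] at [i] is free; putting [B] there makes mutual
       independence over [K] and [i] give the product formula. *)
    pose A' j := if j == i then B else A j.
    have KD : [set` (i |` K)%fset] `<=` D.
      by move=> j /=; rewrite !inE => /orP[/eqP -> //|jK]; apply/JD/KJ.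
    have mA' j : measurable (A' j) by rewrite /A'; case: ifP.
    have A'E j : j \in K -> A' j = A j.
      by rewrite /A'; case: eqP => // ->; rewrite (negbTE iK).
    have := indX KD mA'.
    rewrite big_fsetU1//= {2}/A' eqxx.
    rewrite [in X in _ = (_ * X)%E](eq_big_seq (fun j => P (X j @^-1` A j))); last first.
      by move=> j /A'E ->.
    rewrite -(indX (subset_trans KJ JD) mA) => <-; congr (P _).
    apply/seteqP; split => [t [h hB] j /=|t h].
      rewrite !inE => /orP[/eqP ->|jK]; first by rewrite /A' eqxx.
      by rewrite A'E//; exact: h.
    split=> [j /= jK|].
      by have := h j; rewrite /= !inE jK orbT A'E//; apply.
    by have := h i; rewrite /= !inE eqxx /A' eqxx; apply.
  - move=> _; rewrite [X in (X < _)%E](_ : _ = P (setT `&` X i @^-1` B))//.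
    by rewrite setTI (le_lt_trans (probability_le1 P mXB))// ltry.
by rewrite muleC -rE -H.
Qed.

Lemma independent_past {dS : measure_display} {S : measurableType dS}
    (J : set I) (i : I) (V : Omega -> S) :
  J `<=` D -> D i -> ~ J i ->
  past_measurable J V ->
  independent_rv V (X i).
Proof.
move=> JD Di nJi mV A B mA mB; apply: (independent_sigma_cylinders JD Di nJi) => //.
by rewrite -[V @^-1` A]setTI; exact: mV.
Qed.

End cylinder.

(** * Fubini for a pair of independent random variables *)

Section fubini.
Context {dS dW : measure_display} {S : measurableType dS} {W : measurableType dW}.
Variables (V : {RV P >-> S}) (w : {RV P >-> W}).
Hypothesis indVw : independent_rv V w.
Local Open Scope ereal_scope.

Let VwT (o : Omega) : S * W := (V o, w o).

Let mVwT : measurable_fun setT VwT.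
Proof. exact: measurable_fun_pair. Qed.

Let Vw : {RV P >-> (S * W)%type} := mfun_Sub (mem_set mVwT).

(** Independence says that the joint law and the product of the laws agree on rectangles, which
    determine the product measure. *)
Let VwE (A : set (S * W)) : measurable A ->
  distribution P Vw A = (distribution P V \x distribution P w) A.
Proof.
move=> mA; apply/esym; exact: product_measure_unique.
Qed.

Section fubini_fun.
Variable H : S * W -> \bar R.
Hypotheses (mH : measurable_fun setT H)
  (iH : P.-integrable setT (fun o => H (V o, w o))).

Let iH' : (distribution P V \x distribution P w).-integrable setT H.
Proof.
have /integrableP[_ fin] : (distribution P Vw).-integrable setT H.
  exact: integrable_pushforward.
apply/integrableP; split => //.
rewrite (eq_measure_integral (distribution P Vw))// => A mA _.
exact/esym/VwE.
Qed.

Lemma indep_integral :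
  \int[P]_o H (V o, w o) =
  \int[distribution P V]_v \int[distribution P w]_x H (v, x).
Proof.
transitivity (\int[distribution P Vw]_p H p); first by rewrite integral_pushforward.
rewrite (eq_measure_integral (distribution P V \x distribution P w)); last first.
  by move=> A mA _; exact: VwE.
by rewrite -integral12_prod_meas1.
Qed.

Lemma indep_ae_integrable :
  {ae distribution P V, forall v,
     (distribution P w).-integrable setT (fun x => H (v, x))}.
Proof. exact: ae_integrable1. Qed.

Lemma indep_integrable_fubini :
  (distribution P V).-integrable setT
    (fun v => \int[distribution P w]_x H (v, x)).
Proof. exact: integrable_fubini_F. Qed.

End fubini_fun.
End fubini.
End independence.

(** * Orthogonality of centred fresh noise to functions of the past *)

Section orthogonality.
Context {dO dT dW : measure_display} {Omega : measurableType dO}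
  {T : measurableType dT} {W : measurableType dW} {R : realType}
  (P : probability Omega R).
Variables (zeta : Omega -> R) (z : Omega -> T) (w : {RV P >-> W}) (e : T * W -> R).
Hypotheses (mzeta : measurable_fun setT zeta) (mz : measurable_fun setT z)
  (me : measurable_fun setT e)
  (ind : independent_rv P (fun o => (zeta o, z o)) w)
  (ie : P.-integrable setT (fun o => (e (z o, w o))%:E))
  (ize : P.-integrable setT (fun o => (zeta o * e (z o, w o))%:E))
  (e0 : forall B, measurable B ->
     (\int[P]_(o in z @^-1` B) (e (z o, w o))%:E = 0)%E).
Local Open Scope ereal_scope.

Let mU : measurable_fun setT (fun o => (zeta o, z o)).
Proof. exact: measurable_fun_pair. Qed.

Let Z : {RV P >-> T} := mfun_Sub (mem_set mz).
Let U : {RV P >-> (R * T)%type} := mfun_Sub (mem_set mU).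

Let indZ : independent_rv P Z w.
Proof.
move=> A B mA mB; apply: (ind (A := snd @^-1` A) (B := B)) => //.
by rewrite -[_ @^-1` _]setTI; exact: measurable_snd.
Qed.

Let mE : measurable_fun setT (EFin \o e).
Proof. exact/measurable_EFinP. Qed.

Let phi v := \int[distribution P w]_x (e (v, x))%:E.

(** By Fubini the integral of [phi] over a measurable set A is the mean of the noise on the event
    that z lies in A, which is 0 by [e0]. A function whose integrals all vanish is 0 almost
    everywhere. *)
Let phi0 : ae_eq (distribution P Z) setT phi (cst 0).
Proof.
have iphi : (distribution P Z).-integrable setT phi.
  exact: (indep_integrable_fubini indZ mE).
apply: integral_ae_eq => // A _ mA.
rewrite [RHS]integral0 integral_mkcond.
(* Restricting the integrand instead of the domain gives an integral over the whole space, to which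
   Fubini applies. *)
pose H := (EFin \o e) \_ (A `*` setT).
have mAT : measurable (A `*` [set: W]) by exact: measurableX.
have mH : measurable_fun setT H.
  by apply/(measurable_restrictT _ mAT)/measurable_funTS.
have HE : (fun o => H (Z o, w o)) = (fun o => (e (z o, w o))%:E) \_ (z @^-1` A).
  apply/funext => o; rewrite /H !patchE /=.
  have -> // : ((z o, w o) \in A `*` setT) = (o \in z @^-1` A).
  by apply/idP/idP; rewrite !inE => // -[].
have mzA : measurable (z @^-1` A) by rewrite -[_ @^-1` _]setTI; exact: mz.
have iH : P.-integrable setT (fun o => H (Z o, w o)).
  rewrite HE; apply/(integrable_mkcond _ mzA).
  by apply: integrableS ie.
transitivity (\int[distribution P Z]_v \int[distribution P w]_x H (v, x)).
  apply: eq_integral => v _; rewrite patchE /phi; case: ifPn => vA.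
    apply: eq_integral => x _; rewrite /H patchE ifT//.
    by move: vA; rewrite !inE.
  rewrite integral0_eq// => x _; rewrite /H patchE ifF//.
  by apply/negbTE; apply: contra vA; rewrite !inE => -[].
by rewrite -(indep_integral indZ mH iH) HE -integral_mkcond e0.
Qed.

Let ae_snd (Q : T -> Prop) :
  {ae distribution P Z, forall v, Q v} -> {ae distribution P U, forall u, Q u.2}.
Proof.
move=> [N [mN N0 QN]]; exists (snd @^-1` N); split.
- by rewrite -[_ @^-1` _]setTI; exact: measurable_snd.
- exact: N0.
- by move=> u /= nQ; exact: QN.
Qed.

(** Fubini is applied with the pair (zeta, z) as first variable: the inner integral is zeta times
    [phi], hence 0 almost everywhere. *)
Lemma integral_noise_orthogonal :
  \int[P]_o (zeta o * e (z o, w o))%:E = 0.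
Proof.
pose H (p : (R * T) * W) := (p.1.1 * e (p.1.2, p.2))%:E.
have mH : measurable_fun setT H.
  apply/measurable_EFinP; apply: measurable_funM.
    by apply: measurableT_comp => //; exact: measurable_fst.
  apply: measurableT_comp => //; apply: measurable_fun_pair.
    by apply: measurableT_comp; [exact: measurable_snd|exact: measurable_fst].
  exact: measurable_snd.
have indU : independent_rv P U w by exact: ind.
rewrite (indep_integral indU mH ize).
have := indep_integrable_fubini indU mH ize => /measurable_int mF.
transitivity (\int[distribution P U]_u cst 0 u); last by rewrite integral0.
apply: ae_eq_integral => //.
have h1 := ae_snd phi0.
(* For almost every query point the noise is integrable in [w] alone, which lets the factor zeta
   leave the inner integral. *)
have h2 := ae_snd (indep_ae_integrable indZ mE ie).
move: h1 h2; apply: filterS2 => -[a v] /= phiv iv _.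
rewrite /H/=; under eq_integral do rewrite EFinM.
by rewrite integralZl// -/(phi v) phiv// mule0.
Qed.

End orthogonality.

(** * Square-integrable random vectors *)

Section square_integrable.
Context {dO : measure_display} {Omega : measurableType dO} {R : realType}
  (P : probability Omega R).
Implicit Types (X Y : Omega -> R) (c : R).

Definition fin_mean X : Prop := P.-integrable setT (EFin \o X).

Lemma fin_mean_le X Y : measurable_fun setT X -> (forall o, `|X o| <= Y o) ->
  fin_mean Y -> fin_mean X.
Proof.
move=> mX XY; apply: le_integrable => //; first exact/measurable_EFinP.
move=> o _ /=; rewrite lee_fin.
exact: le_trans (XY o) (ler_norm _).
Qed.

Lemma fin_mean_cst c : fin_mean (fun=> c).
Proof. exact: finite_measure_integrable_cst. Qed.

Lemma fin_meanD X Y : fin_mean X -> fin_mean Y -> fin_mean (fun o => X o + Y o).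
Proof. by move=> iX iY; exact: (integrableD measurableT iX iY). Qed.

Lemma fin_meanZ c X : fin_mean X -> fin_mean (fun o => c * X o).
Proof. by move=> iX; exact: (integrableZl measurableT c iX). Qed.

Lemma fin_mean_sum (I : Type) (s : seq I) (X : I -> Omega -> R) :
  (forall i, fin_mean (X i)) -> fin_mean (fun o => \sum_(i <- s) X i o).
Proof.
move=> iX; elim: s => [|i s IH].
  by under [X in fin_mean X]eq_fun do rewrite big_nil; exact: fin_mean_cst.
by under [X in fin_mean X]eq_fun do rewrite big_cons; exact: fin_meanD.
Qed.

Lemma fin_mean_measurable X : fin_mean X -> measurable_fun setT X.
Proof. by move=> /measurable_int /measurable_EFinP. Qed.

Lemma integral_fin_mean X : fin_mean X ->
  (\int[P]_o (X o)%:E)%E = (\int[P]_o X o)%:E.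
Proof. by move=> iX; rewrite fineK//; exact: integrable_fin_num. Qed.

Lemma Rintegral_sum (I : Type) (s : seq I) (X : I -> Omega -> R) :
  (forall i, fin_mean (X i)) ->
  \int[P]_o (\sum_(i <- s) X i o) = \sum_(i <- s) \int[P]_o X i o.
Proof.
move=> iX; elim: s => [|i s IH].
  by under eq_Rintegral do rewrite big_nil; rewrite Rintegral_cst// mul0r big_nil.
under eq_Rintegral do rewrite big_cons.
by rewrite RintegralD ?big_cons ?IH//; [exact: iX|exact: fin_mean_sum].
Qed.

Lemma Rintegral_probability_cst c : \int[P]_o c = c.
Proof. rewrite Rintegral_cst// -[RHS]mulr1; congr (_ * _).
by rewrite [X in fine X]probability_setT. Qed.

Definition sq_integrable X : Prop :=
  measurable_fun setT X /\ fin_mean (fun o => X o ^+ 2).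

Lemma sq_integrable_le X Y : measurable_fun setT X ->
  (forall o, X o ^+ 2 <= Y o) -> fin_mean Y -> sq_integrable X.
Proof.
move=> mX XY iY; split => //; apply: fin_mean_le iY; first exact: measurable_funX.
by move=> o; rewrite ger0_norm ?sqr_ge0.
Qed.

Lemma sq_integrable_cst c : sq_integrable (fun=> c).
Proof. by split; [exact: measurable_cst|exact: fin_mean_cst]. Qed.

Lemma sq_integrableD X Y : sq_integrable X -> sq_integrable Y ->
  sq_integrable (fun o => X o + Y o).
Proof.
move=> [mX iX] [mY iY]; apply: (@sq_integrable_le _ (fun o => 2 * X o ^+ 2 + 2 * Y o ^+ 2)).
- exact: measurable_funD.
- by move=> o; have := sqr_ge0 (X o - Y o); nra.
- by apply: fin_meanD; exact: fin_meanZ.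
Qed.

Lemma sq_integrableZ c X : sq_integrable X -> sq_integrable (fun o => c * X o).
Proof.
move=> [mX iX]; split; first exact: measurable_funM.
under [X in fin_mean X]eq_fun do rewrite exprMn.
exact: fin_meanZ.
Qed.

Lemma sq_integrableM X Y : sq_integrable X -> sq_integrable Y ->
  fin_mean (fun o => X o * Y o).
Proof.
move=> [mX iX] [mY iY]; apply: (@fin_mean_le _ (fun o => X o ^+ 2 + Y o ^+ 2)).
- exact: measurable_funM.
- move=> o; rewrite normrM -(real_normK (num_real (X o))) -(real_normK (num_real (Y o))).
  by have := sqr_ge0 (`|X o| - `|Y o|); have := normr_ge0 (X o); have := normr_ge0 (Y o); nra.
- exact: fin_meanD.
Qed.

(** The almost-everywhere comparison is made between nonnegative functions, so the positive part of
    [X] stands in between; as c >= 0, it is still at most [c] almost everywhere. *)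
Lemma Rintegral_le_ae_cst X c : fin_mean X -> 0 <= c ->
  {ae P, forall o, X o <= c} -> \int[P]_o X o <= c.
Proof.
move=> iX c0 Xc; rewrite -lee_fin -integral_fin_mean//.
apply: (@le_trans _ _ (\int[P]_o (EFin \o X)^\+ o)%E).
  apply: le_integral => //; first exact: integrable_funepos.
  by move=> o _; rewrite funeposE le_max lexx.
have -> : c%:E = (\int[P]_o cst c%:E o)%E.
  by rewrite integral_cst// [X in (_ * X)%E]probability_setT mule1.
apply: ae_ge0_le_integral => //.
- by apply: measurable_funepos; exact: measurable_int iX.
- apply: filterS Xc => o Xo _.
  by rewrite funeposE ge_max /= !lee_fin Xo.
Qed.

Section random_vector.
Context {d : nat}.
Implicit Types U V : Omega -> 'rV[R]_d.

Definition vec_sq_integrable V : Prop := forall i, sq_integrable (fun o => V o 0 i).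

Lemma vec_sq_integrable_cst (v : 'rV[R]_d) : vec_sq_integrable (fun=> v).
Proof. by move=> i; exact: sq_integrable_cst. Qed.

Lemma vec_sq_integrableD U V : vec_sq_integrable U -> vec_sq_integrable V ->
  vec_sq_integrable (fun o => U o + V o).
Proof.
move=> iU iV i; under [X in sq_integrable X]eq_fun do rewrite mxE.
exact: sq_integrableD.
Qed.

Lemma vec_sq_integrableZ c V : vec_sq_integrable V ->
  vec_sq_integrable (fun o => c *: V o).
Proof.
move=> iV i; under [X in sq_integrable X]eq_fun do rewrite mxE.
exact: sq_integrableZ.
Qed.

Lemma vec_sq_integrableB U V : vec_sq_integrable U -> vec_sq_integrable V ->
  vec_sq_integrable (fun o => U o - V o).
Proof.
move=> iU iV; under [X in vec_sq_integrable X]eq_fun do rewrite -scaleN1r.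
by apply: vec_sq_integrableD => //; exact: vec_sq_integrableZ.
Qed.

Lemma fin_mean_dotp U V : vec_sq_integrable U -> vec_sq_integrable V ->
  fin_mean (fun o => dotp (U o) (V o)).
Proof. by move=> iU iV; apply: fin_mean_sum => i; exact: sq_integrableM. Qed.

Lemma vec_sq_integrable_le V (Y : Omega -> R) :
  (forall i, measurable_fun setT (fun o => V o 0 i)) ->
  (forall o, dotp (V o) (V o) <= Y o) -> fin_mean Y -> vec_sq_integrable V.
Proof.
move=> mV VY iY i; apply: sq_integrable_le iY => // o.
exact: le_trans (sqr_coord_le_dotp _ _) (VY o).
Qed.

Lemma vec_sq_integrable_measurable V : vec_sq_integrable V ->
  measurable_fun setT (V : Omega -> borel_rV R d).
Proof. by move=> iV; apply: measurable_borel_rV => i; have [] := iV i. Qed.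

End random_vector.
End square_integrable.

(** * Expected decrease of the Lyapunov function *)

Lemma independent_rv_comp {dO d1 d2 d3 : measure_display}
    {Omega : measurableType dO} {S : measurableType d1} {S' : measurableType d2}
    {W : measurableType d3} {R : realType} (P : probability Omega R)
    (V : Omega -> S) (w : Omega -> W) (g : S -> S') :
  measurable_fun setT g -> independent_rv P V w ->
  independent_rv P (g \o V) w.
Proof.
move=> mg ind A B mA mB; rewrite comp_preimage; apply: ind => //.
by rewrite -[_ @^-1` _]setTI; exact: mg.
Qed.

Section expected_step.
Context {R : realType} {d : nat}.
Variables (mu L sigma : R) (f : 'rV[R]_d -> R) (xs : 'rV[R]_d).
Hypotheses (mu0 : 0 < mu) (muL : mu <= L) (fS : S_class mu L f)
  (fmin : forall x, f xs <= f x).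
Context {dO dW : measure_display} {Omega : measurableType dO}
  {W : measurableType dW} (P : probability Omega R).
Implicit Types x y : Omega -> 'rV[R]_d.

Lemma measurable_objective : measurable_fun setT (f : borel_rV R d -> R).
Proof.
apply: continuous_measurable_borel_rV => x.
by have [df _ _] := fS; exact/differentiable_continuous/df.
Qed.

Lemma measurable_grad :
  measurable_fun setT (grad f : borel_rV R d -> borel_rV R d).
Proof. by apply: continuous_measurable_rV_rV; have [] := fS. Qed.

(** Smoothness puts f - f(xs) between 0 and L/2 times the squared distance to [xs]. *)
Lemma fin_mean_objective x :
  vec_sq_integrable P x -> fin_mean P (fun o => f (x o)).
Proof.
move=> ix.
have mfx : measurable_fun setT (fun o => f (x o)).
  apply: (measurableT_comp measurable_objective).
  exact: vec_sq_integrable_measurable ix.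
have ixs : vec_sq_integrable P (fun o => x o - xs).
  by apply: vec_sq_integrableB => //; exact: vec_sq_integrable_cst.
have idist := fin_meanZ (L / 2) (fin_mean_dotp ixs ixs).
have i0 : fin_mean P (fun o => f (x o) - f xs).
  apply: (fin_mean_le _ _ idist); first exact: measurable_funB.
  move=> o; rewrite ger0_norm ?subr_ge0//; exact: (suboptimality_le mu0 muL fS fmin).
under [X in fin_mean P X]eq_fun do rewrite -[f _](subrK (f xs)).
by apply: fin_meanD => //; exact: fin_mean_cst.
Qed.

Lemma vec_sq_integrable_grad x :
  vec_sq_integrable P x -> vec_sq_integrable P (fun o => grad f (x o)).
Proof.
move=> ix.
have ixs : vec_sq_integrable P (fun o => x o - xs).
  by apply: vec_sq_integrableB => //; exact: vec_sq_integrable_cst.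
apply: (vec_sq_integrable_le _ _ (fin_meanZ (L ^+ 2) (fin_mean_dotp ixs ixs))).
  move=> i; apply: measurable_borel_rV_coord.
  apply: (measurableT_comp measurable_grad).
  exact: vec_sq_integrable_measurable ix.
by move=> o; exact: (dotp_grad_le_dist mu0 muL fS fmin).
Qed.

Variables (gt : 'rV[R]_d -> W -> 'rV[R]_d) (w : {RV P >-> W}).
Hypothesis mgt : measurable_fun setT
  (fun p : borel_rV R d * W => gt p.1 p.2 : borel_rV R d).

Let noise y o := gt (y o) (w o) - grad f (y o).

Lemma vec_sq_integrable_noise y : oracle_answer P sigma f gt y w ->
  vec_sq_integrable P (noise y).
Proof.
move=> [ug [V [iX _ _ _] _]].
apply: (vec_sq_integrable_le _ _ iX) => [i|o]; last by rewrite sqr_enorm.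
have [/fin_mean_measurable m1 /fin_mean_measurable m2 _ _] := ug i.
under eq_fun do rewrite mxE [X in _ + X]mxE.
exact: measurable_funB.
Qed.

Lemma mean_sq_noise_le y : oracle_answer P sigma f gt y w ->
  \int[P]_o dotp (noise y o) (noise y o) <= sigma ^+ 2.
Proof.
move=> [_ [V [iX iV _ XV] Vs]].
apply: le_trans (Rintegral_le_ae_cst iV (sqr_ge0 _) Vs).
rewrite le_eqVlt; apply/orP; left; apply/eqP.
under eq_Rintegral do rewrite -sqr_enorm.
rewrite /Rintegral XV//; exists setT => //; by rewrite setTI.
Qed.

(* The conditional mean of the noise is only known given the query point y, but
   the Lyapunov function also involves x; independence of w from the past is
   what makes the noise orthogonal to every function of the past. *)
Lemma noise_orthogonal {dS : measure_display} {S : measurableType dS}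
    (U : Omega -> S) (hy hz : S -> 'rV[R]_d) :
  measurable_fun setT U ->
  measurable_fun setT (hy : S -> borel_rV R d) ->
  measurable_fun setT (hz : S -> borel_rV R d) ->
  independent_rv P U w ->
  oracle_answer P sigma f gt (hy \o U) w ->
  vec_sq_integrable P (hz \o U) ->
  \int[P]_o dotp (noise (hy \o U) o) (hz (U o)) = 0.
Proof.
move=> mU mhy mhz indU orc iz.
have inoise := vec_sq_integrable_noise orc.
rewrite /dotp Rintegral_sum => [|i]; last exact: sq_integrableM.
apply: big1 => i _.
pose e (p : borel_rV R d * W) : R := gt p.1 p.2 0 i - grad f p.1 0 i.
have eE o : noise (hy \o U) o 0 i = e (hy (U o), w o).
  by rewrite /noise /e !mxE.
have me : measurable_fun setT e.
  apply: measurable_funB; first exact: measurable_borel_rV_coord.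
  apply: measurable_borel_rV_coord.
  by apply: (measurableT_comp measurable_grad); exact: measurable_fst.
have mz : measurable_fun setT (fun o => hz (U o) 0 i).
  exact: (measurableT_comp (measurable_borel_rV_coord i mhz) mU).
have my : measurable_fun setT ((hy \o U) : Omega -> borel_rV R d).
  exact: (measurableT_comp mhy mU).
(* Of the past, only one coordinate of the weight and the query point are kept; independence passes
   to this image of [U]. *)
pose g (s : S) : R * borel_rV R d := (hz s 0 i, hy s).
have mg : measurable_fun setT g.
  by apply: measurable_fun_pair => //; exact: measurable_borel_rV_coord.
have [/(_ i)[ig igr _ ggr] _] := orc.
have := @integral_noise_orthogonal _ _ _ _ _ _ _ P (fun o => hz (U o) 0 i)
  (hy \o U : Omega -> borel_rV R d) w e mz my me (independent_rv_comp mg indU).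
have -> : (fun o => (e ((hy \o U) o, w o))%:E) =
    (fun o => (gt ((hy \o U) o) (w o) 0 i)%:E -
              (grad f ((hy \o U) o) 0 i)%:E)%E by [].
move=> H; rewrite /Rintegral.
under eq_integral do rewrite eE mulrC.
rewrite H//.
- exact: integrableB.
- rewrite (_ : (fun o => _) =
      EFin \o (fun o => (hz \o U) o 0 i * noise (hy \o U) o 0 i)).
    exact: (sq_integrableM (iz i) (inoise i)).
  by apply/funext => o; rewrite /= eE.
- move=> B mB.
  have mA : measurable ((hy \o U) @^-1` B) by rewrite -[_ @^-1` _]setTI; exact: my.
  rewrite integralB//; [|exact: integrableS ig|exact: integrableS igr].
  rewrite ggr ?subee//.
    by apply: integrable_fin_num => //; exact: integrableS igr.
  by exists B => //; rewrite setTI.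
Qed.

Variable alpha : R.
Hypotheses (alpha0 : 0 < alpha) (alphaL : L * alpha <= 1).
Let s := Num.sqrt (mu * alpha).
Let V := lyapunov mu f xs alpha.

Lemma fin_mean_lyapunov x x' : vec_sq_integrable P x -> vec_sq_integrable P x' ->
  fin_mean P (fun o => V (x o) (x' o)).
Proof.
move=> ix ix'.
have iv : vec_sq_integrable P (fun o => x o - xs - (1 - s) *: (x' o - xs)).
  apply: vec_sq_integrableB.
    by apply: vec_sq_integrableB => //; exact: vec_sq_integrable_cst.
  apply: vec_sq_integrableZ.
  by apply: vec_sq_integrableB => //; exact: vec_sq_integrable_cst.
apply: fin_meanD; last exact/fin_meanZ/fin_mean_dotp.
by apply: fin_meanD; [exact: fin_mean_objective|exact: fin_mean_cst].
Qed.

Lemma mean_lyapunov_step (beta : R) x x' :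
  beta = (1 - s) / (1 + s) ->
  let y o := (1 + beta) *: x o - beta *: x' o in
  let x1 o := y o - alpha *: gt (y o) (w o) in
  vec_sq_integrable P x -> vec_sq_integrable P x' ->
  independent_rv P (fun o => (x o : borel_rV R d, x' o : borel_rV R d)) w ->
  oracle_answer P sigma f gt y w ->
  vec_sq_integrable P x1 /\
  \int[P]_o V (x1 o) (x o) <=
    (1 - s) * \int[P]_o V (x o) (x' o) + alpha / 2 * (1 + L * alpha) * sigma ^+ 2.
Proof.
move=> betaE y x1 ix ix' ind orc.
have iy : vec_sq_integrable P y.
  by apply: vec_sq_integrableB; exact: vec_sq_integrableZ.
have ie := vec_sq_integrable_noise orc.
have ig := vec_sq_integrable_grad iy.
have x1E o : x1 o = y o - alpha *: (grad f (y o) + noise y o).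
  by rewrite /noise subrKC.
have ix1 : vec_sq_integrable P x1.
  rewrite (funext x1E); apply: vec_sq_integrableB => //.
  by apply: vec_sq_integrableZ; exact: vec_sq_integrableD.
split => //.
pose hy (p : borel_rV R d * borel_rV R d) : 'rV[R]_d :=
  (1 + beta) *: p.1 - beta *: p.2.
(* The vector multiplying the noise in [lyapunov_step], as a function of the two iterates. *)
pose hz (p : borel_rV R d * borel_rV R d) : 'rV[R]_d :=
  (L * alpha ^+ 2) *: grad f (hy p) - (hy p - xs - (1 - s) *: (p.1 - xs)).
have mhy : measurable_fun setT (hy : _ -> borel_rV R d).
  apply: measurable_borel_rVB; apply: measurable_borel_rVZ.
    exact: measurable_fst.
  exact: measurable_snd.
have mhz : measurable_fun setT (hz : _ -> borel_rV R d).
  apply: measurable_borel_rVB.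
    by apply: measurable_borel_rVZ; exact: (measurableT_comp measurable_grad).
  apply: measurable_borel_rVB.
    by apply: measurable_borel_rVB => //; exact: measurable_cst.
  apply: measurable_borel_rVZ; apply: measurable_borel_rVB.
    exact: measurable_fst.
  exact: measurable_cst.
pose U o := (x o : borel_rV R d, x' o : borel_rV R d).
have mU : measurable_fun setT U.
  by apply: measurable_fun_pair; exact: vec_sq_integrable_measurable.
have iz : vec_sq_integrable P (hz \o U).
  apply: vec_sq_integrableB; first exact: vec_sq_integrableZ.
  apply: vec_sq_integrableB.
    by apply: vec_sq_integrableB => //; exact: vec_sq_integrable_cst.
  apply: vec_sq_integrableZ.
  by apply: vec_sq_integrableB => //; exact: vec_sq_integrable_cst.
have orth : \int[P]_o dotp (noise y o) (hz (U o)) = 0.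
  exact: (noise_orthogonal mU mhy mhz ind orc iz).
have iV := fin_mean_lyapunov ix ix'.
have iez := fin_mean_dotp ie iz.
have iee := fin_mean_dotp ie ie.
have c0 : 0 <= alpha / 2 * (1 + L * alpha).
  have La : 0 <= L * alpha by rewrite mulr_ge0 ?ltW// (lt_le_trans mu0).
  by apply: mulr_ge0; [rewrite divr_ge0// ltW|rewrite addr_ge0].
have step := le_Rintegral measurableT (fin_mean_lyapunov ix1 ix)
  (fin_meanD (fin_meanD (fin_meanZ (1 - s) iV) iez)
    (fin_meanZ (alpha / 2 * (1 + L * alpha)) iee)).
apply: (le_trans (step _)).
  move=> o _; rewrite x1E.
  exact: (lyapunov_step mu0 muL fS alpha0 alphaL (noise y o) betaE erefl erefl).
rewrite RintegralD//; [|by apply: fin_meanD => //; exact: fin_meanZ|exact: fin_meanZ].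
rewrite RintegralD//; last exact: fin_meanZ.
rewrite orth addr0 !RintegralZl//.
by rewrite lerD2l ler_wpM2l// mean_sq_noise_le.
Qed.

End expected_step.

(** * Mean suboptimality along the stages *)

Section masg_mean.
Context {R : realType} {d : nat}.
Variables (mu L sigma : R) (f : 'rV[R]_d -> R) (x0 xs : 'rV[R]_d)
  (n_ : nat -> nat) (alpha : nat -> R).
Context {dO dW : measure_display} {Omega : measurableType dO}
  {W : measurableType dW} (P : probability Omega R).
Variables (gt : 'rV[R]_d -> W -> 'rV[R]_d) (w : nat -> nat -> {RV P >-> W}).

Let G := oracle_answers gt w.
Let D := [set p : nat * nat | (1 <= p.1)%N /\ (1 <= p.2 <= n_ p.1)%N].
Let noise (p : nat * nat) : {RV P >-> W} := w p.1 p.2.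
Let X k m o := masg_x mu n_ alpha x0 (G o) k m.
Let Y k m o := masg_y mu n_ alpha x0 (G o) k m.
Let s k := Num.sqrt (mu * alpha k).
Let V k := lyapunov mu f xs (alpha k).

Hypotheses (mu0 : 0 < mu) (muL : mu <= L) (fS : S_class mu L f)
  (fmin : forall x, f xs <= f x)
  (alpha0 : forall k, (0 < k)%N -> 0 < alpha k)
  (alphaL : forall k, (0 < k)%N -> L * alpha k <= 1)
  (mgt : measurable_fun setT
     (fun p : borel_rV R d * W => gt p.1 p.2 : borel_rV R d))
  (indw : mutually_independent D noise)
  (orc : forall k m : nat, (1 <= k)%N -> (1 <= m <= n_ k)%N ->
     oracle_answer P sigma f gt (Y k m) (w k m)).

(** The order is lexicographic and strict: the query (k, m) is excluded, so that its noise is fresh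
    with respect to the iterates it is computed from. *)
Definition past (k m : nat) : set (nat * nat) :=
  [set p | ((1 <= p.1)%N /\ (1 <= p.2 <= n_ p.1)%N) /\
           ((p.1 < k)%N \/ p.1 = k /\ (p.2 < m)%N)].

Let adapted k m (Z : Omega -> borel_rV R d) : Prop :=
  past_measurable noise (past k m) Z.

Lemma past_step k m : past k m `<=` past k m.+1.
Proof.
move=> p [Dp h]; split => //.
by case: h => [->|[-> h]]; [left|right; split => //; exact: ltnW].
Qed.

Lemma past_next_stage k m : past k m `<=` past k.+1 1.
Proof.
move=> p [Dp h]; split => //; left.
by case: h => [/ltnW|[-> _]].
Qed.

Lemma masg_xS k m o : (0 < m)%N ->
  X k m.+1 o = Y k m o - alpha k *: gt (Y k m o) (w k m o).
Proof. exact: masg_xE. Qed.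

(** Iterates adapted to [past k m] are independent of [w k m], which is what the one-step estimate
    asks for. Adaptedness and square integrability pass to the new iterate, so the three conclusions
    go through induction together. *)
Lemma masg_step k m : (0 < k)%N -> (1 <= m <= n_ k)%N ->
  adapted k m (X k m) -> adapted k m (X k m.-1) ->
  vec_sq_integrable P (X k m) -> vec_sq_integrable P (X k m.-1) ->
  [/\ adapted k m.+1 (X k m.+1), vec_sq_integrable P (X k m.+1)
    & \int[P]_o V k (X k m.+1 o) (X k m o) <=
      (1 - s k) * \int[P]_o V k (X k m o) (X k m.-1 o)
      + alpha k / 2 * (1 + L * alpha k) * sigma ^+ 2].
Proof.
move=> k0 mn aX aX' iX iX'; have m0 : (0 < m)%N by case/andP: mn.
have Dkm : D (k, m) by [].
have ind : independent_rv P
    (fun o => (X k m o : borel_rV R d, X k m.-1 o : borel_rV R d)) (w k m).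
  apply: (independent_past indw (J := past k m) (i := (k, m))) => //.
  - by move=> p [].
  - by move=> [_ /= [|[_]]]; rewrite ltnn.
  - exact: measurable_fun_pair aX aX'.
have [iX1 dec] := mean_lyapunov_step mu0 muL fS fmin mgt (alpha0 k0) (alphaL k0)
  (erefl _ : masg_beta mu alpha k = _) iX iX' ind (orc k0 mn).
have X1E : X k m.+1 = fun o => Y k m o - alpha k *: gt (Y k m o) (w k m o).
  by apply/funext => o; exact: masg_xS.
split; rewrite ?X1E//.
have aY : adapted k m.+1 (Y k m).
  apply: (past_measurable_le (@past_step k m)).
  by apply: measurable_borel_rVB; apply: measurable_borel_rVZ.
have aw : past_measurable noise (past k m.+1) (noise (k, m)).
  by apply: past_measurable_noise; split => //; right; split.
apply: measurable_borel_rVB => //; apply: measurable_borel_rVZ.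
exact: (measurableT_comp mgt (measurable_fun_pair aY aw)).
Qed.

Lemma masg_stage_adapted k m : (0 < k)%N -> (m <= n_ k)%N ->
  adapted k 1 (X k 1) -> vec_sq_integrable P (X k 1) ->
  [/\ adapted k m.+1 (X k m.+1), adapted k m.+1 (X k m),
      vec_sq_integrable P (X k m.+1) & vec_sq_integrable P (X k m)].
Proof.
move=> k0 + aX iX; elim: m => [//|m IH] mn.
have [aX1 aX0 iX1 iX0] := IH (ltnW mn).
have [aX2 iX2 _] := masg_step (m := m.+1) k0 mn aX1 aX0 iX1 iX0.
by split => //; exact: past_measurable_le (@past_step _ _) aX1.
Qed.

Lemma masg_start_adapted k : adapted k.+1 1 (X k.+1 1) /\
  vec_sq_integrable P (X k.+1 1).
Proof.
elim: k => [|k [aX iX]].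
  by split; [exact: measurable_cst|exact: vec_sq_integrable_cst].
(* By conversion, [X k.+2 1] is the last iterate of stage [k.+1]. *)
have [aX1 _ iX1 _] := masg_stage_adapted (k := k.+1) isT (leqnn _) aX iX.
by split; [exact: past_measurable_le (@past_next_stage _ _) aX1|exact: iX1].
Qed.

Lemma masg_adapted k m : (0 < k)%N -> (m <= n_ k)%N ->
  [/\ adapted k m.+1 (X k m.+1), adapted k m.+1 (X k m),
      vec_sq_integrable P (X k m.+1) & vec_sq_integrable P (X k m)].
Proof.
case: k => // k _ mn; have [aX iX] := masg_start_adapted k.
exact: masg_stage_adapted.
Qed.

(** The noise added per step is at most alpha sigma^2, because (1 + L alpha) / 2 <= 1, and alpha / s
    sigma^2 is the fixed point of a -> (1 - s) a + alpha sigma^2. *)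
Lemma mean_lyapunov_stage k m : (0 < k)%N -> (m <= n_ k)%N ->
  \int[P]_o V k (X k m.+1 o) (X k m o) <=
  (1 - s k) ^+ m * \int[P]_o V k (X k 1 o) (X k 0 o)
  + alpha k / s k * sigma ^+ 2.
Proof.
move=> k0; have s0 : 0 < s k by apply: sqrt_mu_alpha_gt0 => //; exact: alpha0.
have s1 : s k <= 1.
  exact: (sqrt_mu_alpha_le1 muL (alpha0 k0) (alphaL k0)).
have c0 : 0 <= alpha k / s k * sigma ^+ 2.
  by rewrite mulr_ge0 ?sqr_ge0// divr_ge0// ltW// alpha0.
elim: m => [|m IH] mn; first by rewrite expr0 mul1r lerDl.
have [aX1 aX0 iX1 iX0] := masg_adapted k0 (ltnW mn).
have [_ _ dec] := masg_step (m := m.+1) k0 mn aX1 aX0 iX1 iX0.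
apply: (le_trans dec).
have s1' : 0 <= 1 - s k by rewrite subr_ge0.
have := ler_wpM2l s1' (IH (ltnW mn)); rewrite mulrDr mulrA -exprS => IHs.
have cs : alpha k / 2 * (1 + L * alpha k) * sigma ^+ 2 <=
    s k * (alpha k / s k * sigma ^+ 2).
  rewrite [leRHS](_ : _ = alpha k * sigma ^+ 2); last first.
    by field; rewrite gt_eqF.
  rewrite ler_wpM2r ?sqr_ge0//.
  rewrite [leLHS](_ : _ = alpha k * ((1 + L * alpha k) / 2)); last by field.
  rewrite ler_piMr// ?(ltW (alpha0 k0))//.
  by rewrite ler_pdivrMr// mul1r -[2]/(1 + 1) lerD2l alphaL.
by apply: le_trans (lerD IHs cs) _; rewrite -addrA lerD2l -mulrDl subrK mul1r.
Qed.

Definition gap k m : R := \int[P]_o f (X k m o) - f xs.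

Lemma gap_mean k m : fin_mean P (fun o => f (X k m o)) ->
  gap k m = \int[P]_o (f (X k m o) - f xs).
Proof.
move=> iX; rewrite RintegralB//; last exact: fin_mean_cst.
by rewrite Rintegral_probability_cst.
Qed.

(** The factor 2 comes from [lyapunov_diag_le], as [X k 0] and [X k 1] coincide by conversion. *)
Lemma gap_stage k m : (0 < k)%N -> (m <= n_ k)%N ->
  gap k m.+1 <= 2 * (1 - s k) ^+ m * gap k 1 + alpha k / s k * sigma ^+ 2.
Proof.
move=> k0 mn.
have s1 : s k <= 1.
  exact: (sqrt_mu_alpha_le1 muL (alpha0 k0) (alphaL k0)).
have [_ _ iX1 iX0] := masg_adapted k0 mn.
have [_ _ iS iS0] := masg_adapted k0 (leq0n (n_ k)).
have ifX1 := fin_mean_objective mu0 muL fS fmin iX1.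
have ifS := fin_mean_objective mu0 muL fS fmin iS.
have iV := fin_mean_lyapunov mu0 muL fS fmin (alpha k) iX1 iX0.
have iV1 := fin_mean_lyapunov mu0 muL fS fmin (alpha k) iS iS0.
have igap Z : fin_mean P (fun o => f (Z o)) -> fin_mean P (fun o => f (Z o) - f xs).
  by move=> iZ; apply: fin_meanD => //; exact: fin_mean_cst.
rewrite !gap_mean//.
apply: (@le_trans _ _ (\int[P]_o V k (X k m.+1 o) (X k m o))).
  apply: le_Rintegral => //; first exact: igap.
  by move=> o _; apply: suboptimality_le_lyapunov; exact: alpha0.
apply: (le_trans (mean_lyapunov_stage k0 mn)).
rewrite lerD2r [2 * _]mulrC -mulrA ler_wpM2l ?exprn_ge0 ?subr_ge0//.
rewrite -RintegralZl//; last exact: igap.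
apply: le_Rintegral => //; first exact/fin_meanZ/igap.
by move=> o _; apply: (lyapunov_diag_le mu0 muL fS fmin); exact: alpha0.
Qed.

Lemma gap_first : gap 1 1 = f x0 - f xs.
Proof. by congr (_ - _); exact: (Rintegral_probability_cst P (f x0)). Qed.

Lemma mean_masg_x k m : (0 < k)%N -> (m <= n_ k)%N ->
  ('E_P[fun o => f (X k m.+1 o)] - (f xs)%:E = (gap k m.+1)%:E)%E.
Proof.
move=> k0 mn; have [_ _ iX _] := masg_adapted k0 mn.
have ifX := fin_mean_objective mu0 muL fS fmin iX.
by rewrite unlock integral_fin_mean.
Qed.

Lemma gap_ge0 k m : (0 < k)%N -> (m <= n_ k)%N -> 0 <= gap k m.+1.
Proof.
move=> k0 mn; have [_ _ iX _] := masg_adapted k0 mn.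
have ifX := fin_mean_objective mu0 muL fS fmin iX.
rewrite gap_mean//; apply: Rintegral_ge0 => o _.
by rewrite subr_ge0.
Qed.

End masg_mean.

(** * Numerical bounds for the schedule *)

(** From 1 - s <= exp(-s). It turns the logarithmic stage lengths into contraction factors. *)
Lemma expr1B_le {R : realType} (s a : R) (n : nat) :
  s <= 1 -> 0 < a -> ln a <= n%:R * s -> (1 - s) ^+ n <= a^-1.
Proof.
move=> s1 a0 an; apply: (@le_trans _ _ (expR (- s) ^+ n)).
  by rewrite lerXn2r ?nnegrE ?subr_ge0 ?expR_ge0//; exact: expR_ge1Dx.
rewrite -expRM_natl mulrN -[a in a^-1]lnK// -expRN ler_expR lerN2//.
Qed.

(** * The stage recursion for an abstract array [g] of mean suboptimalities *)

Section schedule.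
Context {R : realType}.
Variables (mu L sigma Delta : R) (n_ : nat -> nat) (alpha : nat -> R)
  (g : nat -> nat -> R).
Let K := Num.sqrt (L / mu).
Let B := sigma ^+ 2 / (mu * K).
Let s k := Num.sqrt (mu * alpha k).
Let c : R := (Num.ceil (K * ln 8))%:~R.

Hypotheses (mu0 : 0 < mu) (muL : mu <= L) (sigma0 : 0 < sigma)
  (n1E : (n_ 1%N)%:Z =
     Num.ceil (K * ln (2 * L * Delta / (sigma ^+ 2 * K))))
  (n1_gt0 : (1 <= n_ 1%N)%N)
  (alpha1E : alpha 1%N = 1 / L)
  (nkE : forall k : nat, (2 <= k)%N ->
     (n_ k)%:Z = 2 ^+ k * Num.ceil (K * ln 8))
  (alphakE : forall k : nat, (2 <= k)%N -> alpha k = 1 / (2 ^+ (2 * k) * L)).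

Let L0 : 0 < L. Proof. exact: lt_le_trans muL. Qed.

Let K0 : 0 < K. Proof. by rewrite sqrtr_gt0 divr_gt0. Qed.

Let KK : K ^+ 2 = L / mu. Proof. by rewrite sqr_sqrtr// divr_ge0// ltW. Qed.

(** Eliminating [L] leaves rational identities in [mu] and [K], within reach of [field]. *)
Let LE : L = mu * K ^+ 2. Proof. by rewrite KK mulrC divfK// gt_eqF. Qed.

Let B0 : 0 < B. Proof. by rewrite divr_gt0 ?exprn_gt0// mulr_gt0. Qed.

Let pow2_gt0 k : 0 < (2 : R) ^+ k. Proof. by rewrite exprn_gt0. Qed.

Lemma stepsize_gt0 k : (0 < k)%N -> 0 < alpha k.
Proof.
case: k => [//|[_|k _]]; first by rewrite alpha1E divr_gt0.
by rewrite alphakE// divr_gt0// mulr_gt0.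
Qed.

Lemma stepsize_le k : (0 < k)%N -> L * alpha k <= 1.
Proof.
case: k => [//|[_|k _]]; first by rewrite alpha1E mul1r divff// gt_eqF.
rewrite alphakE// mul1r invfM mulrCA divff ?gt_eqF// mulr1.
by rewrite invf_le1// exprn_ege1// ler1n.
Qed.

Let s1E : s 1 = K^-1.
Proof.
rewrite /s alpha1E LE -[K^-1]ger0_norm ?invr_ge0 ?ltW// -sqrtr_sqr.
by congr Num.sqrt; field; rewrite !gt_eqF.
Qed.

Let skE k : (2 <= k)%N -> s k = (2 ^+ k * K)^-1.
Proof.
move=> k2; rewrite /s alphakE// LE.
have p0 : 0 <= (2 ^+ k * K)^-1 by rewrite invr_ge0 mulr_ge0// ltW.
rewrite -[RHS]ger0_norm// -sqrtr_sqr mulnC exprM.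
by congr Num.sqrt; field; rewrite !gt_eqF.
Qed.

Let noise1E : alpha 1 / s 1 * sigma ^+ 2 = B.
Proof. by rewrite s1E alpha1E LE /B; field; rewrite !gt_eqF. Qed.

Let noisekE k : (2 <= k)%N -> alpha k / s k * sigma ^+ 2 = B / 2 ^+ k.
Proof.
move=> k2; rewrite skE// alphakE// LE /B mulnC exprM.
by field; rewrite !gt_eqF.
Qed.

Let s_le1 k : (0 < k)%N -> s k <= 1.
Proof.
move=> k0.
exact: (sqrt_mu_alpha_le1 muL (stepsize_gt0 k0) (stepsize_le k0)).
Qed.

Let c_ge : K * ln 8 <= c. Proof. exact: ceil_ge. Qed.

Let ln8_gt0 : 0 < ln 8 :> R. Proof. by rewrite ln_gt0// ltr1n. Qed.

Let c_gt0 : 0 < c. Proof. by apply: lt_le_trans c_ge; rewrite mulr_gt0. Qed.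

Let K1 : 1 <= K.
Proof. by rewrite -sqrtr1 ler_wsqrtr// ler_pdivlMr// mul1r. Qed.

(** Rounding up adds at most 1, which K >= 1 absorbs. *)
Let c_le : c <= K * (1 + ln 8).
Proof.
have /ltW := ceilB1_lt (K * ln 8); rewrite rmorphB/= -/c lerBlDr => /le_trans.
by apply; rewrite mulrDr mulr1 addrC lerD2r.
Qed.

Let nkR k : (2 <= k)%N -> (n_ k)%:R = 2 ^+ k * c.
Proof.
move=> k2; have := congr1 (fun z : int => z%:~R : R) (nkE k2).
by rewrite rmorphM rmorphXn.
Qed.

Lemma stage_length_gt0 k : (0 < k)%N -> (0 < n_ k)%N.
Proof.
case: k => [//|[_ //|k _]].
by rewrite -(ltr0n R) nkR// mulr_gt0.
Qed.

Lemma masg_N_le k : (0 < k)%N ->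
  (masg_N n_ k)%:R <= (n_ 1)%:R + 2 ^+ k.+1 * c.
Proof.
(* The geometric sum of 2^i from i = 2 to j + 1 is 2^(j+2) - 4. *)
suff H j : (masg_N n_ j.+1)%:R <= (n_ 1)%:R + (2 ^+ j.+2 - 4) * c.
  case: k => // k _; apply: le_trans (H k) _.
  by rewrite lerD2l ler_wpM2r ?(ltW c_gt0)// gerBl.
elim: j => [|j IH]; first by rewrite /masg_N big_nat1 [_ ^+ 2]expr2; lra.
rewrite /masg_N big_nat_recr//= natrD nkR//.
apply: le_trans (lerD IH (lexx _)) _.
by rewrite -addrA lerD2l -mulrDl ler_wpM2r ?(ltW c_gt0)// [2 ^+ j.+3]exprS; lra.
Qed.

Hypotheses (g_ge0 : forall k m, (0 < k)%N -> (m <= n_ k)%N -> 0 <= g k m.+1)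
  (g1 : g 1 1 <= Delta)
  (g_next : forall k, g k.+2 1 = g k.+1 (n_ k.+1).+1)
  (g_stage : forall k m, (0 < k)%N -> (m <= n_ k)%N ->
     g k m.+1 <= 2 * (1 - s k) ^+ m * g k 1 + alpha k / s k * sigma ^+ 2).

(** The length of stage 1 brings (1 - s)^n_1 down to 1 / A, and 2 Delta / A = B, the noise level of
    that stage. *)
Lemma gap_after_first : g 2 1 <= 2 * B.
Proof.
pose A := 2 * L * Delta / (sigma ^+ 2 * K).
(* A first stage of length at least 1 forces a positive ceiling. Then A > 0 follows, since [ln]
   takes the value 0 on nonpositive reals. *)
have lnA : 0 < ln A.
  have : (0 < Num.ceil (K * ln A))%R by rewrite -n1E ltz_nat.
  by rewrite ceil_gt0 pmulr_rgt0.
have A0 : 0 < A.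
  by rewrite ltNge; apply/negP => A_le0; move: lnA; rewrite ln0// ltxx.
have n1s : ln A <= (n_ 1)%:R * s 1.
  rewrite s1E ler_pdivlMr// mulrC.
  have -> : (n_ 1)%:R = (Num.ceil (K * ln A))%:~R :> R by rewrite -n1E.
  exact: ceil_ge.
rewrite g_next; apply: le_trans (g_stage _ (leqnn _)) _ => //.
rewrite noise1E [leRHS](_ : _ = B + B); last by rewrite mulr_natl.
rewrite lerD2r -mulrA.
have g10 := g_ge0 (k := 1) isT (leq0n _).
have s1 := s_le1 (k := 1) isT.
apply: (@le_trans _ _ (2 * (A^-1 * Delta))).
  by rewrite ler_wpM2l// ler_pM ?exprn_ge0 ?subr_ge0// expr1B_le.
rewrite le_eqVlt; apply/orP; left; apply/eqP.
have D0 : Delta != 0.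
  by apply/eqP => D0; move: A0; rewrite /A D0 mulr0 mul0r ltxx.
rewrite /A /B LE; field.
by rewrite D0 !gt_eqF.
Qed.

(** A stage k >= 2 multiplies the gap by at most 2 / 8 and adds B / 2^k: from 4 B / 2^(k-1) it leads
    to 2 B / 2^k + B / 2^k, within 4 B / 2^k. *)
Lemma gap_after_stage k : g k.+2 1 <= 4 * B / 2 ^+ k.+1.
Proof.
elim: k => [|k IH]; first by apply: le_trans gap_after_first _; rewrite expr1; lra.
rewrite g_next; apply: le_trans (g_stage _ (leqnn _)) _ => //.
rewrite noisekE//.
(* The powers of 2 in the length and in the rate cancel: n_k s_k = c / K >= ln 8. *)
have h : (1 - s k.+2) ^+ n_ k.+2 <= 8^-1.
  apply: expr1B_le => //; first exact: s_le1.
  rewrite nkR// skE// invfM mulrACA divff ?gt_eqF// mul1r.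
  by rewrite ler_pdivlMr// mulrC.
have gk0 := g_ge0 (k := k.+2) isT (leq0n _).
have := ler_wpM2r gk0 h.
rewrite -mulrA => h'.
rewrite [2 ^+ k.+2]exprS; rewrite exprS in IH.
have -> : B / (2 * 2 ^+ k.+1) = B / 2 ^+ k.+1 / 2 by field; rewrite gt_eqF.
have -> : 4 * B / (2 * 2 ^+ k.+1) = 4 * (B / 2 ^+ k.+1) / 2 by field; rewrite gt_eqF.
rewrite -exprS -mulrA in IH.
have B' : 0 <= B / 2 ^+ k.+1 by rewrite divr_ge0// ltW.
lra.
Qed.

(** 17 = 16 + 1: bounding the contraction by 1, the restart doubles 4 B / 2^(k-1) to 16 B / 2^k, and
    the noise adds B / 2^k. *)
Lemma gap_in_stage k m : (2 <= k)%N -> (m <= n_ k)%N ->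
  g k m.+1 <= 17 * B / 2 ^+ k.
Proof.
case: k => [|[|k]]// _ mn.
apply: le_trans (g_stage _ mn) _ => //; rewrite noisekE//.
have gk0 := g_ge0 (k := k.+2) isT (leq0n _).
have h : (1 - s k.+2) ^+ m <= 1.
  have h1 := s_le1 (k := k.+2) isT.
  have h2 : 0 <= s k.+2 by exact: sqrtr_ge0.
  by rewrite exprn_ile1// ?subr_ge0// gerBl.
have := ler_wpM2r gk0 h; rewrite mul1r -mulrA => h'.
have := gap_after_stage k; rewrite [2 ^+ k.+2]exprS.
have -> : B / (2 * 2 ^+ k.+1) = B / 2 ^+ k.+1 / 2 by field; rewrite gt_eqF.
have -> : 17 * B / (2 * 2 ^+ k.+1) = 17 * (B / 2 ^+ k.+1) / 2 by field; rewrite gt_eqF.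
rewrite -[4 * B / _]mulrA => IH.
lra.
Qed.

Lemma gap_rate k m : (2 <= k)%N -> (0 < m <= n_ k)%N ->
  g k m.+1 <=
  36 * (1 + ln 8) * (sigma ^+ 2 / ((masg_N n_ k.-1 + m - n_ 1)%:R * mu)).
Proof.
move=> k2 /andP[m0 mn]; apply: le_trans (gap_in_stage k2 mn) _.
set r := (_ + _ - _)%N.
have N1 : (n_ 1 <= masg_N n_ k.-1)%N.
  by case: k k2 {mn r} => [|[|k]]//= _; rewrite /masg_N big_nat_recl//= leq_addr.
have r0 : (0 < r)%N by rewrite subn_gt0 (leq_ltn_trans N1)// -addn1 leq_add2l.
have rle : r%:R <= 2 ^+ k.+1 * c.
  rewrite natrB; last by rewrite (leq_trans N1)// leq_addr.
  rewrite lerBlDl; apply: le_trans (masg_N_le _); last exact: ltnW.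
  rewrite ler_nat; case: k k2 mn {r r0 N1} => [|k]//= _ mn.
  by rewrite /masg_N [leqRHS]big_nat_recr//= leq_add2l.
have rle' : r%:R <= 2 * 2 ^+ k * (K * (1 + ln 8)).
  by apply: le_trans rle _; rewrite exprS ler_wpM2l// mulr_ge0// ltW.
have r0' : 0 < r%:R :> R by rewrite ltr0n.
rewrite [leRHS](_ : _ = 36 * (1 + ln 8) * (B * K) / r%:R); last first.
  by rewrite /B; field; rewrite !gt_eqF.
rewrite ler_pdivlMr//.
have h0 : 0 <= 17 * B / 2 ^+ k by rewrite divr_ge0 ?(ltW (pow2_gt0 k))// mulr_ge0 ?(ltW B0).
apply: le_trans (ler_wpM2l h0 rle') _.
(* 34 = 17 * 2, where 2 comes from the bound 2^(k+1) on the elapsed steps, and B K = sigma^2 /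
   mu. *)
rewrite [leLHS](_ : _ = 34 * (1 + ln 8) * (B * K)); last first.
  by field; rewrite gt_eqF.
have h1 : 0 <= (1 + ln 8) * (B * K).
  apply: mulr_ge0; first by rewrite addr_ge0// ltW.
  exact: mulr_ge0 (ltW B0) (ltW K0).
by rewrite -[leLHS]mulrA -[leRHS]mulrA ler_wpM2r// ler_nat.
Qed.

End schedule.

(** * The convergence rate of the multistage scheme *)

Theorem theorem4p1 (R : realType) (d : nat) (mu L sigma Delta : R)
  (f : 'rV[R]_d -> R) (x0 xstar : 'rV[R]_d)
  (n_ : nat -> nat) (alpha : nat -> R)
  (dO : measure_display) (Omega : measurableType dO) (P : probability Omega R)
  (dW : measure_display) (W : measurableType dW)
  (gt : 'rV[R]_d -> W -> 'rV[R]_d) (w : nat -> nat -> {RV P >-> W}) :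
  let kappa := L / mu in
  let G := oracle_answers gt w in
  0 < mu -> mu <= L -> 0 < sigma ->
  S_class mu L f ->
  (forall x, f xstar <= f x) ->
  f x0 - f xstar <= Delta ->
  (n_ 1%N)%:Z =
    Num.ceil (Num.sqrt kappa *
              ln (2 * L * Delta / (sigma ^+ 2 * Num.sqrt kappa))) ->
  (1 <= n_ 1%N)%N ->
  alpha 1%N = 1 / L ->
  (forall k : nat, (2 <= k)%N ->
     (n_ k)%:Z = 2 ^+ k * Num.ceil (Num.sqrt kappa * ln 8)) ->
  (forall k : nat, (2 <= k)%N -> alpha k = 1 / (2 ^+ (2 * k) * L)) ->
  measurable_fun setT
    (fun p : borel_rV R d * W => gt p.1 p.2 : borel_rV R d) ->
  mutually_independent
    [set p : nat * nat | (1 <= p.1)%N /\ (1 <= p.2 <= n_ p.1)%N]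
    (fun p => w p.1 p.2) ->
  (forall k m : nat, (1 <= k)%N -> (1 <= m <= n_ k)%N ->
     oracle_answer P sigma f gt
       (fun o => masg_y mu n_ alpha x0 (G o) k m) (w k m)) ->
  forall n : nat, (n_ 1%N < n)%N ->
    ('E_P[fun o => f (masg_iterate mu n_ alpha x0 (G o) n)] - (f xstar)%:E
     <= (36 * (1 + ln 8) * (sigma ^+ 2 / ((n - n_ 1%N)%:R * mu)))%:E)%E.
Proof.
move=> kappa G mu0 muL sigma0 fS fmin x0D n1E n1_gt0 alpha1E nkE alphakE mgt
  indw orc n nn1.
have alpha0 := stepsize_gt0 mu0 muL alpha1E alphakE.
have alphaL := stepsize_le mu0 muL alpha1E alphakE.
have n_gt0 := stage_length_gt0 mu0 muL n1_gt0 nkE.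
have n0 : (0 < n)%N by exact: ltn_trans nn1.
have [k0 Nk kN] := masg_stageP n_gt0 n0.
set k := masg_stage n_ n in k0 Nk kN.
(* Stage 1 is excluded because N_1 = n_1 < n. *)
have k2 : (2 <= k)%N.
  case: k {Nk} k0 kN => [|[|k]]// _.
  by rewrite /masg_N big_nat1 leqNgt nn1.
pose m := (n - masg_N n_ k.-1)%N.
have nE : n = (masg_N n_ k.-1 + m)%N by rewrite subnKC// ltnW.
have m0 : (0 < m)%N by rewrite subn_gt0.
have mn : (m <= n_ k)%N.
  rewrite leq_subLR; apply: leq_trans kN _.
  by case: k k2 {k0 Nk m nE m0} => [//|k] _; rewrite /masg_N big_nat_recr.
have itE o : masg_iterate mu n_ alpha x0 (G o) n = masg_x mu n_ alpha x0 (G o) k m.+1.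
  by rewrite /masg_iterate gtn_eqF.
under [X in ('E_P[X] - _)%E]eq_fun do rewrite itE.
rewrite (mean_masg_x mu0 muL fS fmin alpha0 alphaL mgt indw orc k0 mn) lee_fin.
rewrite nE.
(* The link [g_next] between consecutive stages holds by conversion; the remaining hypotheses on [g]
   are the bounds on the mean gap. *)
apply: (gap_rate mu0 muL sigma0 n1E n1_gt0 alpha1E nkE alphakE
  (g := gap mu f x0 xstar n_ alpha gt w)); rewrite ?m0//.
- exact: (gap_ge0 mu0 muL fS fmin alpha0 alphaL mgt indw orc).
- by rewrite gap_first.
- exact: (gap_stage mu0 muL fS fmin alpha0 alphaL mgt indw orc).
Qed.
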